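(* For all nonnegative integers $a$ and $m$, $$\det_{0\le i,j\le a-1}\left(-\delta_{ij}+\binom{m+i+j}{j}\right)=\begin{cases}0&\text{if $a$ is odd,}\\[4pt]\displaystyle(-1)^{a/2}\prod_{i=0}^{a/2-1}\frac{i!^2\,(\frac m2+i)!^2\,(\frac m2+3i+1)!^2\,(m+3i+1)!^2}{(2i)!\,(2i+1)!\,(\frac m2+2i)!^2\,(\frac m2+2i+1)!^2\,(m+2i)!\,(m+2i+1)!}&\text{if $a$ is even.}\end{cases}$$
   Context: $\delta_{ij}$ is the Kronecker delta. For non-integer $x$, $x!$ means $\Gamma(x+1)$. The determinant of the empty matrix ($a=0$) is 1. *)

(* Defs.v *)
From HB Require Import structures.
From mathcomp Require Import all_boot all_order all_algebra archimedean.
From mathcomp Require Import all_classical all_reals all_analysis.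

Set Implicit Arguments.
Unset Strict Implicit.
Unset Printing Implicit Defensive.

Import Order.TTheory GRing.Theory Num.Theory.
Import numFieldNormedType.Exports.

Local Open Scope classical_set_scope.
Local Open Scope ring_scope.

(* Euler's integral; it is the Gamma function for [0 < x], the only range in
   which it is used here (otherwise the integral diverges and the value is
   meaningless). *)
Definition Gamma (R : realType) (x : R) : R :=
  \int[lebesgue_measure]_(t in `]0, +oo[) (t `^ (x - 1) * expR (- t)).

(* x! for real [x]: the usual factorial at natural numbers, [Gamma (x + 1)] at
   non-integers; meant for [0 <= x]. *)
Definition rfact (R : realType) (x : R) : R :=
  if x \is a Num.nat then (Num.truncn x)`!%:R else Gamma (x + 1).

(* Main.v *)
Require Import Defs.
From mathcomp Require Import all_boot all_order all_algebra.
From mathcomp Require Import all_classical all_reals all_analysis.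
From mathcomp Require Import measurable_realfun ring lra zify.

Set Implicit Arguments.
Unset Strict Implicit.
Unset Printing Implicit Defensive.

Import Order.TTheory GRing.Theory Num.Theory.
Import numFieldNormedType.Exports.

Local Open Scope ring_scope.

(** Let [M_N] be the matrix of size [N], put [h = m / 2] and write [(x)_k] for
    the rising factorial.  Everything rests on an explicit null vector of
    [M_(2n+1)].

    A vector [v] gives a polynomial [sum_(j <= 2n) C(m+x+j, j) v_j] in the row
    index [x], and [M_(2n+1) v = 0] says that it takes the value [v_i] at
    [x = i] for [i <= 2n].  So one looks for a polynomial [f] of degree at most
    [2n] with [f(x) = sum_(j <= 2n) C(m+x+j, j) f(j)].  Replacing [x] by
    [-m-1-x] turns [C(m+x+j, j)] into [(-1)^j C(x, j)]; hence it is enough that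
    [f] is invariant under the reflection [x -> -m-1-x] and that its values at
    [0, ..., 2n] are fixed by the binomial transform
    [F(k) |-> sum_j (-1)^j C(k, j) F(j)], since Newton interpolation then yields
    the identity.  Both hold for the multiple [racah h n] of the balanced
    series
      [4F3(-n, n+h+1, -x, x+2h+1; -2n, 2n+2h+2, h+1; 1)].
    The reflection is visible on the summands.  The invariance under the
    binomial transform is proved through the second-order difference equation
    of this polynomial ([racah_difference_eq]): conjugating the difference
    operator by the binomial transform changes its sign ([diff_op_anti]), so
    the transform of [f] solves the same equation with the same initial value
    ([binom_transform_racah]).

    As [f(0) <> 0], this proves that [det M_(2n+1) = 0] ([det_cspp_odd]).  In
    even size, [M_(2n+2) f = f(2n+1) e] with [e] the last basis vector, once
    the last entry of [f] is replaced by zero.  Multiplying [M_N] on the left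
    by the inverse of the matrix [C(i, j)] and by diagonal matrices on both
    sides makes it skew-symmetric ([skew_core_anti]), so [f] also yields a row
    vector that [M_(2n+2)] sends to a multiple of the transpose of [e].
    Eliminating with these two vectors ([det_almost_kernel]) removes two rows
    and two columns, and leaves
      [det M_(2n+2) =
         - (m+2n+1)/(2n+1) (f(2n+1) / f(2n))^2 det M_(2n)] ([det_cspp_rec]).
    At [x = 2n] and [x = 2n+1] one numerator parameter of the [4F3] cancels
    against a denominator parameter (in the second case [x+2h+1] against
    [2n+2h+2]; in the first [-x] against [-2n]); what remains is a balanced
    [3F2], summed by the Pfaff-Saalschutz theorem ([pfaff_saalschutz]).  The
    resulting quotients of rising factorials are quotients of generalized
    factorials because the Gamma integral satisfies [Gamma(x+1) = x Gamma(x)]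
    and is positive ([GammaS], [Gamma_gt0]). *)

(** * Rising factorials and the Pfaff-Saalschutz sum *)

Definition rising (R : comPzRingType) (x : R) (n : nat) : R :=
  \prod_(i < n) (x + i%:R).
Arguments rising {R} x n.

Lemma rising0 (R : comPzRingType) (x : R) : rising x 0 = 1.
Proof. exact: big_ord0. Qed.

Lemma risingSr (R : comPzRingType) (x : R) n :
  rising x n.+1 = rising x n * (x + n%:R).
Proof. by rewrite /rising big_ord_recr. Qed.

Lemma risingSl (R : comPzRingType) (x : R) n :
  rising x n.+1 = x * rising (x + 1) n.
Proof.
rewrite /rising big_ord_recl addr0; congr (_ * _).
by apply: eq_bigr => i _; rewrite lift0 -addrA nat1r.
Qed.

Lemma rmorph_rising (R S : comPzRingType) (f : {rmorphism R -> S}) (x : R) n :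
  f (rising x n) = rising (f x) n.
Proof.
rewrite /rising rmorph_prod; apply: eq_bigr => i _.
by rewrite rmorphD rmorph_nat.
Qed.

Lemma rising_fact (R : comPzRingType) (p n : nat) :
  p`!%:R * rising p.+1%:R n = (p + n)`!%:R :> R.
Proof.
elim: n => [|n IH]; first by rewrite rising0 mulr1 addn0.
rewrite risingSr mulrA IH addnS factS natrM mulrC; congr (_ * _).
by rewrite -natrD addSn.
Qed.

Lemma rising_bin (R : comPzRingType) (p n : nat) :
  rising p.+1%:R n = n`!%:R * 'C(p + n, n)%:R :> R.
Proof.
elim: n => [|n IH]; first by rewrite rising0 bin0 mulr1.
rewrite risingSr IH -natrD -!natrM; congr _%:R.
have /= H := mul_bin_diag (p + n).+1 n.
by rewrite -mulnA (mulnC 'C(_, _)) addSn H factS addnS mulnCA mulnA.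
Qed.

Lemma rising_opp_nat (R : comPzRingType) (k n : nat) :
  rising (- k%:R) n = (-1) ^+ n * n`!%:R * 'C(k, n)%:R :> R.
Proof.
elim: n => [|n IH]; first by rewrite rising0 bin0 expr0 !mulr1.
rewrite risingSr IH.
have [nk|kn] := leqP n k; last first.
  by rewrite (bin_small kn) (bin_small (ltn_trans kn (ltnSn n))) !mulr0 mul0r.
have -> : - k%:R + n%:R = - (k - n)%:R :> R by rewrite natrB // opprB addrC.
rewrite exprS factS natrM.
have := congr1 (fun x : nat => x%:R : R) (mul_bin_left k n); rewrite !natrM => H.
transitivity (- ((-1) ^+ n * n`!%:R * ((k - n)%:R * 'C(k, n)%:R)) : R).
  by ring.
by rewrite -H; ring.
Qed.

Lemma rising_opp (R : comPzRingType) (x : R) n :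
  rising (- x) n = (-1) ^+ n * rising (x - n%:R + 1) n.
Proof.
elim: n x => [|n IH] x; first by rewrite !rising0 mulr1.
rewrite risingSl (_ : - x + 1 = - (x - 1)); last ring.
rewrite IH exprS [in RHS]risingSr.
rewrite (_ : x - 1 - n%:R + 1 = x - n.+1%:R + 1); last ring.
by ring.
Qed.

Lemma fact_rising_sub (R : comPzRingType) n k : (k <= n)%N ->
  n`!%:R * rising n.+1%:R (n - k) = (2 * n - k)`!%:R :> R.
Proof. by move=> kn; rewrite rising_fact; congr (_`!)%:R; lia. Qed.

Section Saalschutz.
Variables (R : comPzRingType) (a b c : R).

(** The [k]-th term of [3F2(-n, a, b; c, 1+a+b-c-n; 1)], multiplied by
    [(c)_n (c-a-b)_n] so that no division remains; [(c-a-b)_(n-k)] is what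
    becomes of the second denominator parameter. *)
Definition saalschutz_term n k : R :=
  'C(n, k)%:R * rising a k * rising b k * rising (c + k%:R) (n - k) *
  rising (c - a - b) (n - k).
Local Notation T := saalschutz_term.

(** The two coefficients on the right are chosen so that, after summation over
    [k], the coefficients of [T n k] add up to
      [(c+n+k)(c-a-b+n-k) + (a+k)(b+k) = (c-a+n)(c-b+n)],
    which does not depend on [k]. *)
Lemma saalschutz_term_rec n k : (k <= n)%N ->
  T n.+1 k.+1 =
    (c + (n + k.+1)%:R) * (c - a - b + n%:R - k.+1%:R) * T n k.+1 +
    (a + k%:R) * (b + k%:R) * T n k.
Proof.
rewrite leq_eqVlt => /predU1P[->|kn].
  by rewrite /T !subnn (bin_small (ltnSn n)) !binn !rising0 !risingSr; ring.
have [r ->] : exists r, n = (k + r.+1)%N by exists (n - k.+1)%N; lia.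
rewrite /T binS.
have -> : ((k + r.+1).+1 - k.+1 = r.+1)%N by lia.
have -> : (k + r.+1 - k.+1 = r)%N by lia.
have -> : (k + r.+1 - k = r.+1)%N by lia.
have -> : rising (c + k.+1%:R) r.+1 =
    rising (c + k.+1%:R) r * (c + k.+1%:R + r%:R).
  exact: risingSr.
have -> : rising (c + k%:R) r.+1 = (c + k%:R) * rising (c + k.+1%:R) r.
  by rewrite risingSl -addrA natr1.
have := congr1 (fun x : nat => x%:R : R) (mul_bin_left (k + r.+1) k).
rewrite !natrM addKn natrD.
move: ('C(_, k.+1)%:R : R) ('C(_, k)%:R : R) => q p H.
rewrite !risingSr.
set A := rising a k; set B := rising b k.
set C := rising _ r; set D := rising _ r.
transitivity (A * (a + k%:R) * B * (b + k%:R) * C * D * (c - a - b + r%:R) *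
  (p * (c + k%:R) + p * r.+1%:R + q * (c + k.+1%:R + r%:R))); first by ring.
by rewrite (mulrC p r.+1%:R) -H; ring.
Qed.

Lemma pfaff_saalschutz n :
  \sum_(k < n.+1) T n k = rising (c - a) n * rising (c - b) n.
Proof.
elim: n => [|n IH].
  by rewrite big_ord1 /T bin0 !rising0 !mulr1.
rewrite !risingSr mulrACA -IH big_ord_recl.
under eq_bigr => k _ do rewrite lift0 (@saalschutz_term_rec n k (ltn_ord k)).
rewrite big_split /= addrA.
have -> : T n.+1 0 = (c + (n + 0)%:R) * (c - a - b + n%:R - 0%:R) * T n 0.
  by rewrite /T !bin0 !subn0 !rising0 !addr0 !risingSr addn0; ring.
(* [T n n.+1] vanishes, so the first part of the recurrence may be summed over
   the same range as the second. *)
pose U k := (c + (n + k)%:R) * (c - a - b + n%:R - k%:R) * T n k.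
have -> : (c + (n + 0)%:R) * (c - a - b + n%:R - 0%:R) * T n 0 +
  \sum_(i < n.+1) (c + (n + i.+1)%:R) * (c - a - b + n%:R - i.+1%:R) * T n i.+1
  = \sum_(k < n.+1) U k.
  rewrite [RHS](_ : _ = \sum_(k < n.+2) U k); first by rewrite [RHS]big_ord_recl.
  rewrite [RHS]big_ord_recr /=.
  have -> : U n.+1 = 0 by rewrite /U /T (bin_small (ltnSn n)) !mul0r mulr0.
  by rewrite addr0.
rewrite -big_split mulr_suml; apply: eq_bigr => k _ /=; rewrite /U.
by ring.
Qed.
End Saalschutz.

(** * A balanced hypergeometric polynomial *)

(** The [k]-th coefficient of
      [4F3(-n, n+h+1, -x, x+2h+1; -2n, 2n+2h+2, h+1; 1)]
    in the basis [(-x)_k (x+2h+1)_k], multiplied by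
    [(n+1)_n (h+1)_n (2h+2n+2)_n].  This normalization removes all divisions,
    so the polynomial makes sense over any commutative ring, in particular over
    polynomials in [x]. *)
Definition racah_coef (R : comPzRingType) (h : R) (n k : nat) : R :=
  'C(n, k)%:R * rising n.+1%:R (n - k) * rising (h + n.+1%:R) k *
  rising (h + k.+1%:R) (n - k) * rising (2 * h + (2 * n + 2 + k)%:R) (n - k).
Arguments racah_coef {R} h n k.

Definition dual_power (R : comPzRingType) (h x : R) (k : nat) : R :=
  rising (- x) k * rising (x + 2 * h + 1) k.
Arguments dual_power {R} h x k.

Definition racah (R : comPzRingType) (h : R) (n : nat) (x : R) : R :=
  \sum_(k < n.+1) racah_coef h n k * dual_power h x k.
Arguments racah {R} h n x.

Lemma rmorph_racah_coef (R S : comPzRingType) (f : {rmorphism R -> S}) h n k :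
  f (racah_coef h n k) = racah_coef (f h) n k.
Proof.
by rewrite /racah_coef !(rmorph_nat, rmorph_rising, rmorphM, rmorphD).
Qed.

Lemma rmorph_racah (R S : comPzRingType) (f : {rmorphism R -> S}) h n x :
  f (racah h n x) = racah (f h) n (f x).
Proof.
rewrite /racah rmorph_sum; apply: eq_bigr => k _; rewrite rmorphM.
rewrite rmorph_racah_coef /dual_power.
by rewrite !(rmorph_nat, rmorph1, rmorph_rising, rmorphM, rmorphD, rmorphN).
Qed.

Section Racah.
Variables (R : comPzRingType) (h : R) (n : nat).
Local Notation f := (racah h n).

Lemma racah_reflect x : f (- x - 2 * h - 1) = f x.
Proof.
apply: eq_bigr => k _; congr (_ * _); rewrite /dual_power mulrC.
by congr (rising _ k * rising _ k); ring.
Qed.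

(** The ratio of consecutive hypergeometric coefficients, cross-multiplied. *)
Lemma racah_coef_rec k : (k < n)%N ->
  racah_coef h n k.+1 * k.+1%:R * (2 * n - k)%:R * (h + k.+1%:R) *
    (2 * h + (2 * n + 2 + k)%:R) =
  racah_coef h n k * (n - k)%:R * (h + (n + k.+1)%:R).
Proof.
move=> kn; have [r E] : exists r, n = (k + r.+1)%N by exists (n - k.+1)%N; lia.
rewrite /racah_coef.
have -> : (n - k.+1 = r)%N by lia.
have -> : (n - k = r.+1)%N by lia.
have -> : (2 * n - k = n.+1 + r)%N by lia.
have -> : rising (R := R) n.+1%:R r.+1 = rising n.+1%:R r * (n.+1%:R + r%:R).
  exact: risingSr.
have -> : rising (h + k.+1%:R) r.+1 = (h + k.+1%:R) * rising (h + k.+2%:R) r.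
  by rewrite risingSl -addrA natr1.
have -> : rising (h + n.+1%:R) k.+1 =
    rising (h + n.+1%:R) k * (h + n.+1%:R + k%:R).
  exact: risingSr.
have -> : rising (2 * h + (2 * n + 2 + k)%:R) r.+1 =
    (2 * h + (2 * n + 2 + k)%:R) * rising (2 * h + (2 * n + 2 + k.+1)%:R) r.
  by rewrite risingSl -addrA natr1 (addnS _ k).
have := congr1 (fun x : nat => x%:R : R) (mul_bin_left n k).
rewrite !natrM.
have -> : (n - k = r.+1)%N by lia.
move: ('C(_, k.+1)%:R : R) ('C(_, k)%:R : R) => q p H.
set A := rising _ r; set B := rising _ k; set C := rising _ r.
set D := rising _ r.
transitivity (A * B * C * D * (h + k.+1%:R) * (2 * h + (2 * n + 2 + k)%:R) *
  (n.+1%:R + r%:R) * (h + n.+1%:R + k%:R) * (k.+1%:R * q)).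
  by rewrite !natrD; ring.
by rewrite H !natrD; ring.
Qed.

(** The difference operator maps each basis element to a combination of itself
    and of the previous one; the common factor [2x+2h+1] is the only way in
    which [x] enters the coefficients. *)
Lemma dual_power_diff x k :
  (x + 2 * h + 1) * (x - 2 * n%:R) * (x + 2 * n%:R + 2 * h + 2) *
    (dual_power h (x + 1) k.+1 - dual_power h x k.+1) +
  x * (x + 2 * n%:R + 2 * h + 1) * (x - 2 * n%:R - 1) *
    (dual_power h (x - 1) k.+1 - dual_power h x k.+1) -
  (2 * x + 2 * h + 1) * n%:R * (2 * n%:R + 2 * h + 2) * dual_power h x k.+1 =
  2 * (2 * x + 2 * h + 1) *
  (- (n%:R - k.+1%:R) * (h + n%:R + k.+1%:R + 1) * dual_power h x k.+1 +
   k.+1%:R * (2 * n%:R - k%:R) * (h + k.+1%:R) *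
     (2 * h + 2 * n%:R + 2 + k%:R) * dual_power h x k).
Proof.
have E1 : (x + 2 * h + 1) * dual_power h (x + 1) k.+1 =
   - (x + 1) * dual_power h x k * (x + 2 * h + 1 + k%:R) *
     (x + 2 * h + 1 + k.+1%:R).
  rewrite /dual_power risingSl (_ : - (x + 1) + 1 = - x); last ring.
  rewrite mulrCA -[_ * rising (x + 1 + _ + _) _]/(_ * rising _ k.+1).
  rewrite (_ : x + 1 + 2 * h + 1 = x + 2 * h + 1 + 1); last ring.
  by rewrite -risingSl !risingSr; ring.
have E2 : x * dual_power h (x - 1) k.+1 =
   - dual_power h x k * (- x + k%:R) * (- x + k.+1%:R) * (x + 2 * h).
  rewrite /dual_power (risingSl (x - 1 + _ + _)).
  rewrite (_ : - (x - 1) = - x + 1); last ring.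
  rewrite (_ : x - 1 + 2 * h + 1 = x + 2 * h); last ring.
  transitivity (- ((- x) * rising (- x + 1) k.+1) *
    ((x + 2 * h) * rising (x + 2 * h + 1) k)); first by ring.
  by rewrite -risingSl !risingSr; ring.
have E3 : dual_power h x k.+1 =
   dual_power h x k * (- x + k%:R) * (x + 2 * h + 1 + k%:R).
  by rewrite /dual_power !risingSr; ring.
transitivity ((x - 2 * n%:R) * (x + 2 * n%:R + 2 * h + 2) *
    ((x + 2 * h + 1) * dual_power h (x + 1) k.+1 -
     (x + 2 * h + 1) * dual_power h x k.+1) +
  (x + 2 * n%:R + 2 * h + 1) * (x - 2 * n%:R - 1) *
    (x * dual_power h (x - 1) k.+1 - x * dual_power h x k.+1) -
  (2 * x + 2 * h + 1) * n%:R * (2 * n%:R + 2 * h + 2) *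
  dual_power h x k.+1); first by ring.
by rewrite E1 E2 E3; ring.
Qed.

(** The difference equation of the Racah polynomials.  In general it has
    coefficients with denominators [(2x+2h+1)(2x+2h+2)] and
    [(2x+2h+1)(2x+2h)]; the parameter [h+1] makes the second factor of each
    denominator cancel.  Expanded in the basis [dual_power], the left-hand side
    telescopes by [racah_coef_rec]. *)
Lemma racah_difference_eq x :
  (x + 2 * h + 1) * (x - 2 * n%:R) * (x + 2 * n%:R + 2 * h + 2) *
    (f (x + 1) - f x) +
  x * (x + 2 * n%:R + 2 * h + 1) * (x - 2 * n%:R - 1) * (f (x - 1) - f x) -
  (2 * x + 2 * h + 1) * n%:R * (2 * n%:R + 2 * h + 2) * f x = 0.
Proof.
pose D k := (x + 2 * h + 1) * (x - 2 * n%:R) * (x + 2 * n%:R + 2 * h + 2) *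
    (dual_power h (x + 1) k - dual_power h x k) +
  x * (x + 2 * n%:R + 2 * h + 1) * (x - 2 * n%:R - 1) *
    (dual_power h (x - 1) k - dual_power h x k) -
  (2 * x + 2 * h + 1) * n%:R * (2 * n%:R + 2 * h + 2) * dual_power h x k.
transitivity (\sum_(k < n.+1) racah_coef h n k * D k).
  rewrite /racah -!sumrB !mulr_sumr -big_split -sumrB /=.
  by apply: eq_bigr => k _; rewrite /D; ring.
pose V k := 2 * (2 * x + 2 * h + 1) * (racah_coef h n k * (n - k)%:R *
  (h + (n + k.+1)%:R)) * dual_power h x k.
have D0 : racah_coef h n 0 * D 0 = - V 0.
  by rewrite /D /V /dual_power !rising0 subn0 natrD; ring.
have DS k : (k < n)%N -> racah_coef h n k.+1 * D k.+1 = V k - V k.+1.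
  move=> kn; rewrite /D dual_power_diff /V -(racah_coef_rec kn).
  rewrite !natrB ?natrD; [|lia..].
  by ring.
have VN : V n = 0 by rewrite /V subnn mulr0 mul0r mulr0 mul0r.
rewrite big_ord_recl D0.
under eq_bigr => k _ do rewrite lift0 DS //.
have -> : \sum_(i < n) (V i - V i.+1) = V 0 - V n.
  by elim: (n) => [|p IH]; rewrite ?big_ord0 ?subrr // big_ord_recr IH /=; ring.
by rewrite VN subr0 addNr.
Qed.

Lemma racah_at_0 : f 0 =
  rising n.+1%:R n * rising (h + 1) n * rising (2 * h + (2 * n + 2)%:R) n.
Proof.
rewrite /racah big_ord_recl big1 ?addr0.
  by rewrite /racah_coef /dual_power bin0 !rising0 subn0 addn0 !mulr1 !mul1r.
by move=> i _; rewrite /dual_power lift0 oppr0 (risingSl (0 : R)) !mul0r mulr0.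
Qed.
End Racah.

Section RacahValues.
Variables (R : numFieldType) (h : R) (n : nat).

(** Here [(-x)_k] cancels against [(-2n)_k], and the Pfaff-Saalschutz sum with
    parameters [h+n+1], [2h+2n+1] and [2h+2n+2] remains. *)
Lemma racah_at_even : racah h n (2 * n)%:R =
   (-1) ^+ n * (2 * n)`!%:R * rising (h + n.+1%:R) n.
Proof.
have nz : n`!%:R != 0 :> R by rewrite pnatr_eq0 -lt0n fact_gt0.
apply: (mulfI nz).
pose a := h + n.+1%:R; pose b := 2 * h + (2 * n).+1%:R.
pose c := 2 * h + (2 * n + 2)%:R.
transitivity (\sum_(k < n.+1)
  (2 * n)`!%:R * (-1) ^+ n * saalschutz_term a b c n k).
  rewrite mulr_sumr; apply: eq_bigr => -[k /= kn] _.
  have {}kn : (k <= n)%N by [].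
  rewrite /racah_coef /dual_power /saalschutz_term rising_opp_nat.
  transitivity ((n`!%:R * rising n.+1%:R (n - k)) * k`!%:R *
    'C(2 * n, k)%:R * (-1) ^+ k *
    ('C(n, k)%:R * rising (h + n.+1%:R) k * rising (h + k.+1%:R) (n - k) *
     rising (2 * h + (2 * n + 2 + k)%:R) (n - k) *
     rising ((2 * n)%:R + 2 * h + 1) k)); first by ring.
  rewrite fact_rising_sub //.
  have -> : (2 * n)`!%:R = 'C(2 * n, k)%:R * (k`!%:R * (2 * n - k)`!%:R) :> R.
    by rewrite -!natrM bin_fact //; lia.
  rewrite -/a (_ : (2 * n)%:R + 2 * h + 1 = b); last by rewrite /b; ring.
  rewrite (_ : 2 * h + (2 * n + 2 + k)%:R = c + k%:R); last first.
    by rewrite /c natrD addrA.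
  have -> : c - a - b = - (h + n%:R) by rewrite /a /b /c; ring.
  rewrite (rising_opp (h + _)).
  rewrite (_ : h + n%:R - (n - k)%:R + 1 = h + k.+1%:R); last first.
    by rewrite natrB //; ring.
  have -> : (-1) ^+ n = (-1) ^+ k * (-1) ^+ (n - k) :> R.
    by rewrite -exprD subnKC.
  have s2 : (-1) ^+ (n - k) * (-1) ^+ (n - k) = 1 :> R.
    by rewrite -exprMn mulrNN mulr1 expr1n.
  move: ((-1) ^+ (n - k)) s2 => s s2; set e := _ ^+ k.
  transitivity ((s * s) * ((2 * n - k)`!%:R * k`!%:R * 'C(2 * n, k)%:R * e *
    ('C(n, k)%:R * rising a k * rising (h + k.+1%:R) (n - k) *
     rising (c + k%:R) (n - k) * rising b k))); first by rewrite s2 mul1r.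
  by ring.
rewrite -mulr_sumr pfaff_saalschutz.
have -> : c - b = 1%:R by rewrite /c /b; ring.
have -> : c - a = h + n.+1%:R by rewrite /c /a; ring.
have := rising_fact R 0 n; rewrite add0n mul1r => ->.
by ring.
Qed.

(** Here [(x+2h+1)_k] cancels against [(2h+2n+2)_k], and the Pfaff-Saalschutz
    sum with parameters [h+n+1], [-2n-1] and [h+1] remains. *)
Lemma racah_at_odd : racah h n (2 * n).+1%:R =
   (-1) ^+ n * n`!%:R * rising (2 * h + (2 * n + 2)%:R) n *
   rising (h + (2 * n + 2)%:R) n.
Proof.
pose a := h + n.+1%:R; pose b : R := - (2 * n).+1%:R; pose c := h + 1.
transitivity (\sum_(k < n.+1)
  rising (2 * h + (2 * n + 2)%:R) n * saalschutz_term a b c n k).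
  apply: eq_bigr => -[k /= kn] _; have {}kn : (k <= n)%N by [].
  rewrite /racah_coef /dual_power /saalschutz_term.
  have -> : rising (2 * h + (2 * n + 2)%:R) n =
      rising (2 * h + (2 * n + 2)%:R) k *
      rising (2 * h + (2 * n + 2 + k)%:R) (n - k).
    have /(congr1 (rising (2 * h + (2 * n + 2)%:R))) := subnKC kn; move=> <-.
    rewrite /rising big_split_ord /=; congr (_ * _); apply: eq_bigr => i _.
    by rewrite !natrD; ring.
  rewrite (_ : (2 * n).+1%:R + 2 * h + 1 = 2 * h + (2 * n + 2)%:R); last first.
    by ring.
  have -> : c - a - b = n.+1%:R by rewrite /a /b /c; ring.
  rewrite -/a -/b (_ : h + k.+1%:R = c + k%:R); last by rewrite /c; ring.
  by ring.
rewrite -mulr_sumr pfaff_saalschutz.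
have -> : c - b = h + (2 * n + 2)%:R by rewrite /c /b; ring.
have -> : c - a = - n%:R by rewrite /c /a; ring.
by rewrite rising_opp_nat binn; ring.
Qed.
End RacahValues.

(** * Invariance under the binomial transform *)

Section BinomialTransform.
Variable R : comPzRingType.
Implicit Types (F G : nat -> R) (S Z : (nat -> R) -> nat -> R).

Definition binom_transform F (k : nat) : R :=
  \sum_(j < k.+1) (-1) ^+ j * 'C(k, j)%:R * F j.
Local Notation bt := binom_transform.

Lemma binom_transformD F G :
  bt (fun k => F k + G k) = (fun k => bt F k + bt G k).
Proof.
apply: funext => k; rewrite /bt -big_split.
by apply: eq_bigr => j _; rewrite mulrDr.
Qed.

Lemma binom_transformZ c F : bt (fun k => c * F k) = (fun k => c * bt F k).
Proof.
by apply: funext => k; rewrite /bt mulr_sumr; apply: eq_bigr => j _; ring.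
Qed.

Definition shift_seq F (k : nat) : R := F k.+1.
Definition raise_seq F (k : nat) : R := k%:R * F k.-1.

Lemma binom_transform_shift F :
  bt (shift_seq F) = (fun k => bt F k - shift_seq (bt F) k).
Proof.
apply: funext => k.
have -> : bt F k = F 0%N + \sum_(j < k.+1) (-1) ^+ j.+1 * 'C(k, j.+1)%:R * F j.+1.
  transitivity (\sum_(j < k.+2) (-1) ^+ j * 'C(k, j)%:R * F j).
    by rewrite [RHS]big_ord_recr /= bin_small // mulr0 mul0r addr0.
  by rewrite big_ord_recl bin0 !mul1r.
have E : bt F k.+1 =
    F 0%N + \sum_(j < k.+1) (-1) ^+ j.+1 * 'C(k.+1, j.+1)%:R * F j.+1.
  by rewrite /bt big_ord_recl bin0 !mul1r.
rewrite /shift_seq E opprD addrACA subrr add0r -sumrB.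
by apply: eq_bigr => j _; rewrite binS natrD exprS; ring.
Qed.

Lemma binom_transform_raise F :
  bt (raise_seq F) = (fun k => - raise_seq (bt F) k).
Proof.
apply: funext => -[|k].
  by rewrite /bt big_ord1 /raise_seq !mul0r mulr0 oppr0.
rewrite /bt big_ord_recl /raise_seq /= mul0r mulr0 add0r mulr_sumr -sumrN.
apply: eq_bigr => j _; rewrite /bump /= add1n.
transitivity (- ((-1) ^+ j * (j.+1%:R * 'C(k.+1, j.+1)%:R) * F j)).
  by rewrite exprS; ring.
by rewrite -natrM -mul_bin_diag natrM; ring.
Qed.

(** The operator of [racah_difference_eq], written as a noncommutative
    polynomial in the shift [S : F |-> (k |-> F (k+1))] and in
    [Z : F |-> (k |-> k F (k-1))].  Multiplication by [k] is [theta = Z S], so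
    [a = 2h+1] and [b = 2n+2h+2] give [diff_opE].  Keeping [S] and [Z] abstract
    allows the conjugation by the binomial transform, which sends [S] to
    [1 - S] and [Z] to [-Z], to be carried out by substitution. *)
Definition diff_op (a b n : R) S Z F : nat -> R :=
  let theta c G k := Z (S G) k + c * G k in
  fun k =>
  theta a (theta b (theta (- (2 * n)) (fun i => S F i + (-1) * F i))) k +
  theta (2 * n + a) (theta (- (2 * n) - 1)
     (fun i => Z F i + (-1) * Z (S F) i)) k +
  (- (n * (2 * n + a + 1))) * (2 * Z (S F) k + a * F k).

Lemma binom_transform_diff_op a b n F :
  bt (diff_op a b n shift_seq raise_seq F) =
  diff_op a b n (fun G k => G k - shift_seq G k) (fun G k => - raise_seq G k)
    (bt F).
Proof.
have E := (binom_transformD, binom_transformZ, binom_transform_raise,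
  binom_transform_shift).
by rewrite /diff_op !E.
Qed.

(** The substitution produces backward shifts by up to three steps; those
    by more than one step cancel, and the opposite operator is left. *)
Lemma diff_op_anti h n F :
  diff_op (2 * h + 1) (2 * n + 2 * h + 2) n
    (fun G k => G k - shift_seq G k) (fun G k => - raise_seq G k) F =
  (fun k => - diff_op (2 * h + 1) (2 * n + 2 * h + 2) n shift_seq raise_seq F k).
Proof.
apply: funext => -[|[|[|[|k]]]]; rewrite /diff_op /shift_seq /raise_seq /=; ring.
Qed.

Lemma diff_opE h n F k :
  diff_op (2 * h + 1) (2 * n + 2 * h + 2) n shift_seq raise_seq F k =
  (k%:R + 2 * h + 1) * (k%:R - 2 * n) * (k%:R + 2 * n + 2 * h + 2) *
    (F k.+1 - F k) +
  k%:R * (k%:R + 2 * n + 2 * h + 1) * (k%:R - 2 * n - 1) * (F k.-1 - F k) -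
  (2 * k%:R + 2 * h + 1) * n * (2 * n + 2 * h + 2) * F k.
Proof. by case: k => [|[|k]]; rewrite /diff_op /shift_seq /raise_seq /=; ring.
Qed.
End BinomialTransform.

Section Invariance.
Variables (R : realFieldType) (h : R) (n : nat).
Hypothesis h_ge0 : 0 <= h.
Local Notation F := (fun k : nat => racah h n k%:R).

(** At [k = 0] the term in [racah h n (k - 1)] is multiplied by zero, so the
    truncation of [k.-1] is harmless. *)
Lemma racah_diff_op :
  diff_op (2 * h + 1) (2 * n%:R + 2 * h + 2) n%:R
    (@shift_seq R) (@raise_seq R) F = (fun=> 0).
Proof.
apply: funext => k; rewrite diff_opE -[RHS](racah_difference_eq h n k%:R).
congr (_ + _ - _); first by rewrite natr1.
case: k => [|k]; first by rewrite !mul0r.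
by congr (_ * (racah h n _ - _)); rewrite -natr1 addrK.
Qed.

(** The factor [k - 2n] of the leading coefficient is the reason for the bound:
    the difference equation determines the value at [k + 1] from the previous
    ones only as long as [k < 2n]. *)
Lemma binom_transform_racah (k : nat) : (k <= 2 * n)%N ->
  binom_transform F k = racah h n k%:R.
Proof.
have E : diff_op (2 * h + 1) (2 * n%:R + 2 * h + 2) n%:R
    (@shift_seq R) (@raise_seq R) (binom_transform F) = (fun=> 0).
  have := binom_transform_diff_op (2 * h + 1) (2 * n%:R + 2 * h + 2) n%:R F.
  rewrite racah_diff_op diff_op_anti => H.
  apply: funext => i; have := congr1 (fun G => - G i) H => /=.
  rewrite opprK => <-; rewrite /binom_transform big1 ?oppr0 // => j _.
  by rewrite mulr0.
elim/ltn_ind: k => -[_ _|k IH kn].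
  by rewrite /binom_transform big_ord1 /= bin0 !mul1r.
have Fk : binom_transform F k = F k by apply: IH; lia.
have Fk1 : binom_transform F k.-1 = F k.-1 by apply: IH; lia.
have := congr1 (fun G => G k) (etrans E (esym racah_diff_op)).
rewrite !diff_opE Fk Fk1 => /addIr /addIr.
have kR : (k%:R : R) < 2 * n%:R by rewrite -natrM ltr_nat.
have k0 : 0 <= k%:R :> R by [].
have n0 : 0 <= n%:R :> R by [].
move/mulfI => H; apply: (@addIr _ (- racah h n k%:R)); apply: H.
have h0 := h_ge0.
have d1 : k%:R + 2 * h + 1 != 0 by rewrite gt_eqF //; lra.
have d2 : (k%:R - 2 * n%:R : R) != 0 by rewrite lt_eqF // subr_lt0.
have d3 : k%:R + 2 * n%:R + 2 * h + 2 != 0 by rewrite gt_eqF //; lra.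
exact: mulf_neq0 (mulf_neq0 d1 d2) d3.
Qed.
End Invariance.

(** * The null vector *)

Lemma poly_eq_on_nat (R : numDomainType) (N : nat) (p q : {poly R}) :
  (size p <= N)%N -> (size q <= N)%N ->
  (forall k, (k < N)%N -> p.[k%:R] = q.[k%:R]) -> p = q.
Proof.
move=> sp sq pq; apply/eqP; rewrite -subr_eq0; apply/negP => /negP nz.
have : (size [seq k%:R : R | k <- iota 0 N] < size (p - q)%R)%N.
  apply: max_poly_roots => //.
    apply/allP => x /mapP[k]; rewrite mem_iota add0n => kN -> {x}.
    by rewrite rootE hornerD hornerN pq // subrr.
  by rewrite map_inj_uniq ?iota_uniq // => i j /eqP; rewrite eqr_nat => /eqP.
rewrite size_map size_iota ltnNge => /negP; apply.
by rewrite (leq_trans (size_polyD _ _)) // size_polyN geq_max sp.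
Qed.

Lemma size_rising (R : comNzRingType) (p : {poly R}) k :
  (size p <= 2)%N -> (size (rising p k) <= k.+1)%N.
Proof.
move=> sp; elim: k => [|k IH]; first by rewrite rising0 size_poly1.
rewrite risingSr (leq_trans (size_polyMleq _ _)) //.
have : (size (p + k%:R)%R <= 2)%N.
  rewrite (leq_trans (size_polyD _ _)) // geq_max sp.
  by rewrite -polyC_natr (leq_trans (size_polyC_leq1 _)).
by move: IH; move: (size _) (size _) => s1 s2; lia.
Qed.

Section Kernel.
Variable R : realFieldType.

Lemma size_racah (h : R) n : (size (racah h%:P n 'X) <= (2 * n).+1)%N.
Proof.
apply: (leq_trans (size_sum _ _ _)); apply/bigmax_leqP => -[k /= kn] _.
rewrite /dual_power; set c := racah_coef _ _ _.
have -> : c = (racah_coef h n k)%:P by rewrite (rmorph_racah_coef polyC).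
rewrite mul_polyC (leq_trans (size_scale_leq _ _)) //.
rewrite (leq_trans (size_polyMleq _ _)) //.
have s1 : (size (rising (- 'X : {poly R})%R k) <= k.+1)%N.
  by rewrite size_rising // size_polyN size_polyX.
have s2 : (size (rising ('X + 2 * h%:P + 1 : {poly R})%R k) <= k.+1)%N.
  apply: size_rising; rewrite -addrA -[2]/(2%:R) -polyC_natr -polyCM -polyCD.
  by rewrite size_XaddC.
by move: s1 s2; move: (size _) (size _) => s1 s2; lia.
Qed.

(** Newton interpolation at [0, ..., 2n]: [rising (- x) j / j!] is
    [(-1)^j C(x, j)], and by the invariance under the binomial transform both
    sides, of degree at most [2n], agree at these points. *)
Lemma racah_expansion (h : R) n x : 0 <= h ->
  racah h n x =
  \sum_(j < (2 * n).+1) racah h n j%:R / j`!%:R * rising (- x) j.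
Proof.
move=> h0.
have horner_racah y : (racah h%:P n 'X).[y] = racah h n y.
  by rewrite -horner_evalE rmorph_racah /= /horner_eval hornerC hornerX.
pose q : {poly R} := \sum_(j < (2 * n).+1)
  (racah h n j%:R / j`!%:R) *: rising (- 'X) j.
have horner_q y : q.[y] =
    \sum_(j < (2 * n).+1) racah h n j%:R / j`!%:R * rising (- y) j.
  rewrite horner_sum; apply: eq_bigr => j _; rewrite hornerZ; congr (_ * _).
  by rewrite -horner_evalE rmorph_rising /= /horner_eval hornerN hornerX.
rewrite -horner_q -horner_racah; congr _.[x].
apply: (@poly_eq_on_nat _ (2 * n).+1); first exact: size_racah.
  apply: (leq_trans (size_sum _ _ _)); apply/bigmax_leqP => -[j /= jn] _.
  rewrite (leq_trans (size_scale_leq _ _)) // (leq_trans _ jn) //.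
  by rewrite size_rising // size_polyN size_polyX.
move=> k kn; rewrite horner_racah horner_q.
rewrite -(binom_transform_racah h0 kn) /binom_transform.
rewrite (big_ord_widen _ (fun j => (-1) ^+ j * 'C(k, j)%:R * racah h n j%:R) kn).
rewrite big_mkcond; apply: eq_bigr => j _.
have fj : j`!%:R != 0 :> R by rewrite pnatr_eq0 -lt0n fact_gt0.
rewrite rising_opp_nat; case: ltnP => [jk|kj].
  by field.
by rewrite bin_small // !mulr0.
Qed.

(** The expansion at the reflected point [-m-1-i].  It holds for every [i], which
    also gives the image of the vector in the rows below the first [2n+1]. *)
Lemma racah_kernel (m n i : nat) :
  \sum_(j < (2 * n).+1) 'C(m + i + j, j)%:R * racah (m%:R / 2) n j%:R =
  racah (m%:R / 2) n i%:R :> R.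
Proof.
set h : R := m%:R / 2.
have h2 : 2 * h = m%:R by rewrite /h; field.
rewrite -[RHS]racah_reflect racah_expansion; last by rewrite divr_ge0.
apply: eq_bigr => j _.
have -> : - (- i%:R - 2 * h - 1) = (m + i).+1%:R :> R by rewrite h2; ring.
have fj : j`!%:R != 0 :> R by rewrite pnatr_eq0 -lt0n fact_gt0.
by rewrite rising_bin; field.
Qed.
End Kernel.

(** Up to sign, the binomial transform takes iterated differences at [0]. *)
Lemma binom_transform_bin (R : comPzRingType) (m j i : nat) :
  (-1) ^+ i * binom_transform (fun k : nat => 'C(m + k + j, j)%:R : R) i =
  if (i <= j)%N then 'C(m + j, j - i)%:R else 0.
Proof.
elim: i m => [|i IH] m.
  by rewrite /binom_transform big_ord1 /= bin0 addn0 subn0 !mul1r.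
have E : binom_transform (fun k : nat => 'C(m.+1 + k + j, j)%:R : R) i =
    binom_transform (fun k : nat => 'C(m + k + j, j)%:R : R) i -
    binom_transform (fun k : nat => 'C(m + k + j, j)%:R : R) i.+1.
  rewrite -[RHS](congr1 (fun G => G i) (binom_transform_shift _)).
  congr (binom_transform _ i); apply: funext => k.
  by rewrite /shift_seq addSnnS.
have -> : binom_transform (fun k : nat => 'C(m + k + j, j)%:R : R) i.+1 =
    binom_transform (fun k : nat => 'C(m + k + j, j)%:R : R) i -
    binom_transform (fun k : nat => 'C(m.+1 + k + j, j)%:R : R) i.
  by rewrite E; ring.
rewrite exprS mulN1r mulNr mulrBr opprB !IH.
case: ltngtP => [ij|ji|->]; rewrite ?subrr // ?subnn ?bin0 ?subrr //.
rewrite addSn (_ : (j - i = (j - i.+1).+1)%N); last lia.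
by rewrite binS natrD addrAC subrr add0r.
Qed.

(** * Reduction of the determinant by two rows and columns *)

Lemma sign_addnn (R : pzRingType) n : (-1) ^+ (n + n) = 1 :> R.
Proof. by rewrite addnn -signr_odd odd_double. Qed.

(** If [M] maps [v] and [u] to multiples of the last basis vector, then
    replacing by [v] and [u] the column and the row of index [N], the last but
    one, leaves a single nonzero entry in each of these lines.  Since [u] and
    [v] vanish at the last index, the two transition matrices are triangular,
    with determinants [u p] and [v p]. *)
Lemma det_almost_kernel (R : comNzRingType) N (M : 'M[R]_N.+2)
    (u v : 'I_N.+2 -> R) (s t : R) (p : 'I_N.+2) :
  p = N :> nat ->
  (forall i, \sum_j M i j * v j = s * (i == ord_max)%:R) ->
  (forall j, \sum_i u i * M i j = t * (j == ord_max)%:R) ->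
  u ord_max = 0 -> v ord_max = 0 ->
  u p * v p * \det M =
  - (s * t * \det (\matrix_(i < N, j < N)
       M (lift ord_max (lift ord_max i)) (lift ord_max (lift ord_max j)))).
Proof.
move=> pE Mv uM u0 v0.
have pl : lift ord_max ord_max = p by apply/val_inj; rewrite /= /bump pE ltnn.
have p_max : (p == ord_max) = false by rewrite -val_eqE /= pE ltn_eqF.
pose T := \matrix_(i, j) if j == p then v i else (i == j)%:R.
pose U := \matrix_(i, j) if i == p then u j else (i == j)%:R.
have trig (w : 'I_N.+2 -> R) : w ord_max = 0 ->
    \det (\matrix_(i, j) if i == p then w j else (i == j)%:R) = w p.
  move=> w0; rewrite det_trig.
    rewrite (bigD1 p) //= big1 ?mulr1; first by rewrite mxE eqxx.
    by move=> i ip; rewrite mxE (negbTE ip) eqxx.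
  apply/is_trig_mxP => i j ij; rewrite mxE; case: eqP => [ip|_].
    have -> : j = ord_max; last exact: w0.
    by apply/val_inj => /=; move: ij (ltn_ord j); rewrite ip pE ltnS; lia.
  by rewrite -val_eqE ltn_eqF.
have detU : \det U = u p by exact: trig.
have detT : \det T = v p.
  rewrite -det_tr -(trig _ v0); congr (\det _).
  by apply/matrixP => i j; rewrite !mxE (eq_sym j i).
pose W := U *m M *m T.
have -> : u p * v p * \det M = \det W.
  by rewrite /W !det_mulmx detU detT mulrAC.
have MT i j : (M *m T) i j = if j == p then s * (i == ord_max)%:R else M i j.
  rewrite mxE; case: (altP (j =P p)) => [->|jp].
    by rewrite -Mv; apply: eq_bigr => k _; rewrite mxE eqxx.
  rewrite (bigD1 j) //= mxE (negbTE jp) eqxx mulr1 big1 ?addr0 // => k kj.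
  by rewrite mxE (negbTE jp) (negbTE kj) mulr0.
have WE i j : W i j =
    if i == p then (if j == p then 0 else t * (j == ord_max)%:R)
    else if j == p then s * (i == ord_max)%:R else M i j.
  rewrite /W -mulmxA mxE; case: (altP (i =P p)) => [->|ip].
    case: (altP (j =P p)) => [->|jp].
      rewrite (bigD1 ord_max) //= big1 ?addr0 => [|k kmax].
        by rewrite mxE eqxx u0 mul0r.
      by rewrite MT eqxx (negbTE kmax) !mulr0.
    by rewrite -uM; apply: eq_bigr => k _; rewrite MT mxE eqxx (negbTE jp).
  rewrite (bigD1 i) //= mxE (negbTE ip) eqxx mul1r MT big1 ?addr0 // => k ki.
  by rewrite mxE (negbTE ip) (eq_sym i) (negbTE ki) mul0r.
rewrite (expand_det_col W p) (bigD1 ord_max) //= big1 ?addr0 => [|i imax].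
  rewrite WE eqxx eq_sym p_max eqxx mulr1 /cofactor.
  set Y := row' _ _.
  have YE i j : Y i j = W (lift ord_max i) (lift p j) by rewrite !mxE.
  rewrite (expand_det_row Y ord_max) (bigD1 ord_max) //= big1 ?addr0 => [|j jmax].
    rewrite YE WE pl eqxx.
    have -> : lift p ord_max = ord_max :> 'I_N.+2.
      by apply/val_inj; rewrite /= /bump pE leqnn.
    rewrite eq_sym p_max eqxx mulr1 /cofactor /=.
    rewrite pE addSn exprS sign_addnn mulr1 mul1r mulN1r.
    rewrite mulrN mulrA; congr (- (_ * \det _)).
    apply/matrixP => i j; rewrite [RHS]mxE.
    transitivity (Y (lift ord_max i) (lift ord_max j)); first by rewrite !mxE.
    have e : lift p (lift ord_max j) = lift ord_max (lift ord_max j) :> 'I_N.+2.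
      apply/val_inj; rewrite /= /bump pE; have := ltn_ord j; lia.
    have ne (k : 'I_N) : (lift ord_max (lift ord_max k) == p) = false.
      by rewrite -val_eqE /= pE /bump; have := ltn_ord k; lia.
    by rewrite YE WE ne e ne.
  rewrite YE WE pl eqxx eq_sym (negbTE (neq_lift _ _)).
  have -> : (lift p j == ord_max) = false.
    apply/negbTE; rewrite -val_eqE /= /bump pE.
    by move: jmax (ltn_ord j); rewrite -val_eqE /=; lia.
  by rewrite mulr0 mul0r.
by rewrite WE eqxx (negbTE imax) mulr0; case: ifP => _; rewrite mul0r.
Qed.

(** * The determinant *)

(** The name refers to cyclically symmetric plane partitions, whose weighted
    enumeration leads to determinants of this kind. *)
Definition cspp_mx (R : pzRingType) (m a : nat) : 'M[R]_a :=
  \matrix_(i < a, j < a) (- (i == j)%:R + 'C(m + i + j, j)%:R).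

Section Skew.
Variables (R : numFieldType) (m : nat).

(** The entries of [M] multiplied on the left by the inverse
    [((-1)^(i+k) C(i, k))] of [(C(i, k))] (see [binom_inv_cspp]): by
    Vandermonde's convolution, [(C(m+i+j, j))] is the product of [(C(i, k))]
    and the upper triangular matrix [(C(m+j, j-k))]. *)
Definition skew_core (i j : nat) : R :=
  (if (i <= j)%N then 'C(m + j, j - i)%:R else 0) -
  (-1) ^+ (i + j) * 'C(i, j)%:R.

(** The upper and the lower triangular part of [skew_core] come from different
    matrices, but both are [1 / |i-j|!] up to factors that depend on [i] alone
    or on [j] alone; the scaling makes these factors match, and the diagonal is
    zero. *)
Lemma skew_core_anti (i j : nat) :
  (-1) ^+ i * (m + i)`!%:R * skew_core i j * j`!%:R =
  - ((-1) ^+ j * (m + j)`!%:R * skew_core j i * i`!%:R).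
Proof.
wlog ij : i j / (i <= j)%N.
  by move=> H; case/orP: (leq_total i j) => /H // ->; rewrite opprK.
move: ij; rewrite leq_eqVlt => /predU1P[->|ij].
  rewrite /skew_core leqnn subnn bin0 binn sign_addnn mulr1.
  by rewrite subrr mulr0 mul0r oppr0.
have nz : (j - i)`!%:R != 0 :> R by rewrite pnatr_eq0 -lt0n fact_gt0.
rewrite /skew_core (ltnW ij) leqNgt ij (bin_small ij) mulr0 subr0 sub0r /=.
apply: (mulIf nz).
have e1 : (m + j)`!%:R = 'C(m + j, j - i)%:R * ((j - i)`!%:R * (m + i)`!%:R) :> R.
  rewrite -!natrM -(@bin_fact (m + j) (j - i)); last lia.
  by congr (_ * (_ * _`!))%:R; lia.
have e2 : j`!%:R = 'C(j, i)%:R * (i`!%:R * (j - i)`!%:R) :> R.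
  by rewrite -!natrM bin_fact // ltnW.
have s2 : (-1) ^+ j * (-1) ^+ (j + i) = (-1) ^+ i :> R.
  by rewrite exprD mulrA -expr2 sqrr_sign mul1r.
rewrite -s2 e1 [in LHS]e2; ring.
Qed.

Variable a : nat.
Local Notation M := (cspp_mx R m a).
Local Notation Linv i k := ((-1) ^+ (i + k) * 'C(i, k)%:R : R).

Lemma binom_inv_cspp (i j : 'I_a) :
  \sum_(k < a) Linv i k * M k j = skew_core i j.
Proof.
transitivity ((-1) ^+ i * binom_transform (fun k => 'C(m + k + j, j)%:R) i -
   Linv i j).
  rewrite /binom_transform (big_ord_widen a
    (fun k : nat => (-1) ^+ k * 'C(i, k)%:R * 'C(m + k + j, j)%:R)) //.
  rewrite [X in _ = _ * X - _]big_mkcond mulr_sumr.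
  have -> : Linv i j = \sum_(k < a) Linv i k * (k == j)%:R.
    rewrite (bigD1 j) //= eqxx mulr1 big1 ?addr0 // => k kj.
    by rewrite (negbTE kj) mulr0.
  rewrite -sumrB; apply: eq_bigr => k _; rewrite mxE.
  case: ltnP => [_|ik]; first by rewrite exprD; ring.
  by rewrite bin_small //; ring.
by rewrite binom_transform_bin.
Qed.
End Skew.

Section LeftKernel.
Variables (R : numFieldType) (m b : nat).
Local Notation M := (cspp_mx R m b.+1).
Local Notation Linv i k := ((-1) ^+ (i + k) * 'C(i, k)%:R : R).

(** The row vector [w D L'], where [D L' M D'] is the skew-symmetric matrix of
    [skew_core_anti] and [w] is the transpose of [D'^-1 v]; here [L'] is the
    inverse of [(C(i, k))], [D = diag((-1)^i (m+i)!)] and [D' = diag(j!)]. *)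
Definition left_kernel (v : 'I_b.+1 -> R) (k : 'I_b.+1) : R :=
  \sum_(i < b.+1) v i / i`!%:R * ((-1) ^+ i * (m + i)`!%:R) * Linv i k.

Lemma left_kernelP (v : 'I_b.+1 -> R) s :
  (forall i, \sum_j M i j * v j = s * (i == ord_max)%:R) ->
  forall j, \sum_i left_kernel v i * M i j =
    - ((-1) ^+ b * (m + b)`!%:R * s / b`!%:R) * (j == ord_max)%:R.
Proof.
move=> Mv j.
have nz (i : nat) : i`!%:R != 0 :> R by rewrite pnatr_eq0 -lt0n fact_gt0.
apply: (mulIf (nz j)).
transitivity (\sum_(i < b.+1) v i / i`!%:R *
  ((-1) ^+ i * (m + i)`!%:R * skew_core R m i j * j`!%:R)).
  rewrite /left_kernel mulr_suml.
  under eq_bigr => k _ do rewrite -mulrA mulr_suml.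
  rewrite exchange_big; apply: eq_bigr => i _ /=.
  rewrite -binom_inv_cspp mulr_sumr mulr_suml mulr_sumr; apply: eq_bigr => k _.
  by ring.
(* skew-symmetry turns the action on rows into the action on columns *)
transitivity (- ((-1) ^+ j * (m + j)`!%:R) *
  \sum_(i < b.+1) skew_core R m j i * v i).
  rewrite mulr_sumr; apply: eq_bigr => i _; rewrite skew_core_anti.
  by have := nz i; move: (i`!%:R) => x x0; field.
have -> : \sum_(i < b.+1) skew_core R m j i * v i = Linv j b * s.
  transitivity (\sum_(k < b.+1) Linv j k * \sum_(i < b.+1) M k i * v i).
    under [RHS]eq_bigr => k _ do rewrite mulr_sumr.
    rewrite exchange_big; apply: eq_bigr => i _ /=.
    by rewrite -binom_inv_cspp mulr_suml; apply: eq_bigr => k _; rewrite mulrA.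
  rewrite (bigD1 ord_max) //= Mv eqxx mulr1 big1 ?addr0 // => k kmax.
  by rewrite Mv (negbTE kmax) !mulr0.
case: (altP (j =P ord_max)) => [->|jmax] /=.
  rewrite binn sign_addnn.
  by have := nz b; move: (b`!%:R) => x x0; field.
rewrite bin_small ?mulr0 ?mul0r ?mulr0 //.
by move: jmax (ltn_ord j); rewrite -val_eqE /=; lia.
Qed.
End LeftKernel.

Lemma rising_gt0 (R : numDomainType) (x : R) n : 0 < x -> 0 < rising x n.
Proof.
move=> x0; apply: prodr_gt0 => i _; apply: ltr_pwDl => //; exact: ler0n.
Qed.

Section Det.
Variables (R : realFieldType) (m : nat).
Local Notation h := (m%:R / 2 : R).
Local Notation f := (fun n (i : nat) => racah h n i%:R).

Let h_ge0 : 0 <= h. Proof. by rewrite divr_ge0. Qed.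

Let hS_gt0 n : 0 < h + n.+1%:R.
Proof. by rewrite ltr_wpDl. Qed.

Lemma cspp_racah (n i : nat) :
  \sum_(j < (2 * n).+1) (- (i == j)%:R + 'C(m + i + j, j)%:R) * f n j =
  if (i <= 2 * n)%N then 0 else f n i.
Proof.
under eq_bigr do rewrite mulrDl mulNr addrC.
rewrite big_split /= sumrN racah_kernel.
have -> : \sum_(j < (2 * n).+1) (i == j)%:R * f n j =
    \sum_(j < (2 * n).+1 | j == i :> nat) f n j.
  rewrite [RHS]big_mkcond; apply: eq_bigr => j _.
  by rewrite eq_sym; case: eqP; rewrite ?mul1r ?mul0r.
rewrite (big_ord1_eq _ (fun j : nat => f n j)) ltnS.
by case: ifP; rewrite ?subrr ?subr0.
Qed.

Lemma det_cspp_odd n : \det (cspp_mx R m (2 * n).+1) = 0.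
Proof.
apply/eqP; rewrite -det_tr; apply/det0P.
exists (\row_j f n j).
  apply/eqP => /rowP/(_ ord0); rewrite !mxE racah_at_0 => /eqP.
  have k2 : 0 < 2 * h + (2 * n + 2)%:R.
    by rewrite ltr_wpDl ?mulr_ge0 // ltr0n addn2.
  by rewrite !mulf_eq0 !gt_eqF // rising_gt0 // (hS_gt0 0).
apply/rowP => i; rewrite !mxE.
rewrite -[RHS](_ : (if (i <= 2 * n)%N then 0 else f n i) = 0).
  rewrite -cspp_racah; apply: eq_bigr => j _; rewrite !mxE mulrC.
  by rewrite -val_eqE.
by rewrite -ltnS ltn_ord.
Qed.

Lemma det_cspp_rec n :
  \det (cspp_mx R m (2 * n).+2) =
  - ((m + 2 * n).+1%:R / (2 * n).+1%:R * (f n (2 * n).+1 / f n (2 * n)%N) ^+ 2) *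
  \det (cspp_mx R m (2 * n)).
Proof.
set N := (2 * n)%N.
have nz (i : nat) : i`!%:R != 0 :> R by rewrite pnatr_eq0 -lt0n fact_gt0.
have sN : (-1) ^+ N = 1 :> R by rewrite /N mul2n -addnn sign_addnn.
have fN : f n N != 0.
  by rewrite racah_at_even !mulf_neq0 ?signr_eq0 // gt_eqF // rising_gt0.
pose v (j : 'I_N.+2) : R := if j == ord_max then 0 else f n j.
have vmax : v ord_max = 0 by rewrite /v eqxx.
have Mv i : \sum_j cspp_mx R m N.+2 i j * v j = f n N.+1 * (i == ord_max)%:R.
  rewrite big_ord_recr /= vmax mulr0 addr0.
  transitivity (if (i <= N)%N then 0 else f n i).
    rewrite -cspp_racah; apply: eq_bigr => j _; rewrite mxE /v ifF -?val_eqE //=.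
    by rewrite ltn_eqF // ltn_ord.
  case: (altP (i =P ord_max)) => [->|imax]; first by rewrite ltnn mulr1.
  rewrite ifT ?mulr0 //.
  by move: imax (ltn_ord i); rewrite -val_eqE /=; lia.
have uM := left_kernelP Mv.
have left_supp i k : (i < k)%N -> 'C(i, k)%:R = 0 :> R by move=> /bin_small ->.
have u0 : left_kernel m v ord_max = 0.
  rewrite /left_kernel big1 // => i _.
  case: (altP (i =P ord_max)) => [->|imax]; first by rewrite vmax !mul0r.
  rewrite left_supp ?mulr0 //.
  by move: imax (ltn_ord i); rewrite -val_eqE /=; lia.
pose p : 'I_N.+2 := Ordinal (ltnW (ltnSn N.+1)).
have up : left_kernel m v p = f n N / N`!%:R * (m + N)`!%:R.
  rewrite /left_kernel (bigD1 p) //= big1 ?addr0 => [|i ip].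
    rewrite /v ifF; last by rewrite -val_eqE /= ltn_eqF.
    rewrite sign_addnn binn !mulr1 /=.
    by rewrite sN mul1r.
  case: (altP (i =P ord_max)) => [->|imax]; first by rewrite vmax !mul0r.
  rewrite left_supp ?mulr0 //.
  by move: ip imax (ltn_ord i); rewrite -!val_eqE /=; lia.
have vp : v p = f n N by rewrite /v ifF // -val_eqE /= ltn_eqF.
have leading : \matrix_(i < N, j < N) cspp_mx R m N.+2
    (lift ord_max (lift ord_max i)) (lift ord_max (lift ord_max j)) =
    cspp_mx R m N.
  apply/matrixP => i j; rewrite !mxE -!val_eqE /= /bump.
  by rewrite !(leqNgt N) !(leqNgt N.+1) !ltn_ord !(ltn_trans (ltn_ord _)).
have := det_almost_kernel (erefl : p = N :> nat) Mv uM u0 vmax.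
rewrite leading up vp exprS sN.
move: (f n N) (f n N.+1) fN (\det _) (\det _) => x y x0 d d' E.
rewrite addnS !factS !natrM in E.
have [nN nmN] := (nz N, nz (m + N)%N).
have nN1 : N.+1%:R != 0 :> R by rewrite pnatr_eq0.
apply: (mulfI (mulf_neq0 (mulf_neq0 (mulf_neq0 x0 (invr_neq0 nN)) nmN) x0)).
by rewrite E; field; rewrite x0 nat1r nN1 nN.
Qed.

(** Of the generalized factorial [g], only the functional equation along
    [h, h+1, h+2, ...] matters: shifting by [n] the arguments of the quotients
    [g (h+n) / g (h+2n)] and [g (h+3n+1) / g (h+2n+1)] produces the rising
    factorials of [racah_at_even] and [racah_at_odd]. *)
Lemma det_cspp_even n (g : R -> R) :
  (forall x, 0 <= x -> g x != 0) ->
  (forall k, g (h + k.+1%:R) = (h + k.+1%:R) * g (h + k%:R)) ->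
  \det (cspp_mx R m (2 * n)) =
  (-1) ^+ n * \prod_(0 <= i < n)
      ((i`!%:R ^+ 2 * g (h + i%:R) ^+ 2 *
        g (h + (3 * i + 1)%:R) ^+ 2 * (m + 3 * i + 1)`!%:R ^+ 2) /
       ((2 * i)`!%:R * (2 * i + 1)`!%:R * g (h + (2 * i)%:R) ^+ 2 *
        g (h + (2 * i + 1)%:R) ^+ 2 * (m + 2 * i)`!%:R *
        (m + 2 * i + 1)`!%:R)).
Proof.
move=> g_neq0 gS.
have g_shift k l : g (h + (k + l)%:R) = g (h + k%:R) * rising (h + k.+1%:R) l.
  elim: l => [|l IH]; first by rewrite rising0 mulr1 addn0.
  rewrite addnS gS IH risingSr; ring.
have nz (i : nat) : i`!%:R != 0 :> R by rewrite pnatr_eq0 -lt0n fact_gt0.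
elim: n => [|n IH]; first by rewrite det_mx00 big_nil mulr1.
rewrite big_nat_recr //= mulnS add2n det_cspp_rec IH racah_at_even racah_at_odd.
set P := \prod_(_ <= _ < _) _.
have h2 : 2 * h = m%:R by field.
rewrite h2 -natrD (_ : (m + (2 * n + 2) = (m + 2 * n + 1).+1)%N); last lia.
have -> : (m + 3 * n + 1)`!%:R = (m + 2 * n + 1)`!%:R *
    rising (m + 2 * n + 1).+1%:R n :> R.
  by rewrite rising_fact; congr (_`!)%:R; lia.
have -> : (3 * n + 1 = 2 * n + 1 + n)%N by lia.
have -> : g (h + (2 * n)%:R) = g (h + n%:R) * rising (h + n.+1%:R) n.
  by rewrite -g_shift; congr (g (h + _%:R)); lia.
rewrite g_shift (_ : (2 * n + 2 = (2 * n + 1).+1)%N); last lia.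
have gz k : g (h + k%:R) != 0 by rewrite g_neq0 // addr_ge0.
have r0 : rising (h + n.+1%:R) n != 0.
  by rewrite gt_eqF // rising_gt0.
rewrite !addn1 !factS !natrM.
move: (gz n) (gz (2 * n).+1) (nz (2 * n)%N) (nz (m + 2 * n)%N) r0.
move: (g _) (g _) (rising (h + n.+1%:R) n) (rising _ _) (rising _ _).
move=> g1 g2 r1 r2 r3.
have s0 : (-1) ^+ n != 0 :> R by rewrite signr_eq0.
rewrite [(-1) ^+ n.+1]exprS; move: ((-1) ^+ n) s0 => s s0.
move: (_`!%:R) (_`!%:R) (_`!%:R) => a b c g10 g20 b0 c0 r10.
have d1 : (2 * n).+1%:R != 0 :> R by rewrite pnatr_eq0.
have d2 : (m + 2 * n).+1%:R != 0 :> R by rewrite pnatr_eq0.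
move: d1 d2; move: ((2 * n).+1%:R : R) ((m + 2 * n).+1%:R : R) => e1 e2 d1 d2.
by field; rewrite g10 g20 b0 c0 r10 d1 d2.
Qed.
End Det.

(** * The Gamma integral *)

Local Open Scope classical_set_scope.

Section Gamma.
Variable R : realType.
Notation mu := (@lebesgue_measure R).
Implicit Types s t : R.

Definition gamma_integrand (s t : R) : R := t `^ s * expR (- t).
Local Notation G := gamma_integrand.

Lemma measurable_gamma_integrand (D : set R) s : measurable_fun D (G s).
Proof.
apply: measurable_funTS; apply: measurable_funM; first exact: measurable_powR.
by apply: measurableT_comp.
Qed.

(** Half of the exponential decay absorbs the power: [t^s <= 1 + t^N] for an
    integer [N >= s], and [(t/2)^N / N!] is at most [e^(t/2)]. *)
Lemma gamma_integrand_bound s : 0 <= s ->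
  exists C : R, 0 <= C /\
    forall t, 0 <= t -> 0 <= G s t <= C * expR (- (2^-1 * t)).
Proof.
move=> s0; pose N := (Num.truncn s).+1.
have sN : s <= N%:R by rewrite ltW // truncnS_gt.
exists (1 + 2 ^+ N * N`!%:R); split.
  by rewrite addr_ge0 // mulr_ge0 // exprn_ge0.
move=> t t0; rewrite /G mulr_ge0 ?powR_ge0 ?expR_ge0 //=.
have -> : expR (- t) = expR (- (2^-1 * t)) * expR (- (2^-1 * t)).
  by rewrite -expRD; congr expR; field.
rewrite mulrA ler_pM2r ?expR_gt0 // -ler_pdivlMr ?expR_gt0 //.
rewrite -expRN opprK.
have e1 : 1 <= expR (2^-1 * t) by rewrite -expR0 ler_expR mulr_ge0.
have tN : t ^+ N <= 2 ^+ N * N`!%:R * expR (2^-1 * t).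
  have := expR_ge1Dxn N.-1 (_ : 0 <= 2^-1 * t); rewrite prednK //.
  move=> /(_ (mulr_ge0 _ t0)) H.
  rewrite -mulrA -ler_pdivrMl ?exprn_gt0 // -exprVn -exprMn.
  rewrite -ler_pdivrMl ?ltr0n ?fact_gt0 // mulrC.
  by apply: le_trans (H _); rewrite // lerDr.
rewrite mulrDl mul1r.
have [t1|t1] := leP t 1.
  apply: le_trans (_ : 1 <= _).
    by rewrite -[leRHS](congr1 (@^~ s) (powR1 R)) ge0_ler_powR // nnegrE.
  by rewrite ler_wpDr // mulr_ge0 ?expR_ge0 // mulr_ge0 // exprn_ge0.
rewrite ler_wpDl ?expR_ge0 //; apply: le_trans tN.
by rewrite -powR_mulrn // ler_powR // ltW.
Qed.

Lemma integrable_gamma_integrand s : 0 <= s ->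
  mu.-integrable `[0, +oo[ (EFin \o G s).
Proof.
move=> s0; have [C [C0 HC]] := gamma_integrand_bound s0.
apply: (@le_integrable _ _ _ mu _ _ _
   (fun t => (2 * C)%:E * (exponential_pdf 2^-1 t)%:E)%E) => //.
- by apply/measurable_EFinP; exact: measurable_gamma_integrand.
- move=> t /=; rewrite in_itv /= andbT => t0.
  have /andP[g0 gC] := HC _ t0.
  rewrite exponential_pdfE // lee_fin.
  rewrite !ger0_norm //; last by rewrite !mulr_ge0 ?expR_ge0.
  apply: le_trans gC _; rewrite mulNr; lra.
apply: integrableZl => //.
apply: (@integrableS _ _ _ _ setT) => //.
by apply: integrable_exponential_pdf; rewrite invr_gt0.
Qed.

Lemma gamma_integrand_cvgy s : 0 <= s -> G s t @[t --> +oo] --> 0.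
Proof.
move=> s0; have [C [C0 HC]] := gamma_integrand_bound s0.
apply: (@squeeze_cvgr _ _ _ _ (cst 0) (fun t => C * expR (- (2^-1 * t)))).
- by near=> t; apply: HC; near: t; exact: nbhs_pinfty_ge.
- exact: cvg_cst.
rewrite -[X in _ --> X](mulr0 C); apply: cvgM; first exact: cvg_cst.
apply: (@cvg_comp _ _ _ (fun t => 2^-1 * t) (fun t => expR (- t)) _
  (pinfty_nbhs R)); last exact: cvgr_expR.
exact: gt0_cvgMry.
Unshelve. all: by end_near. Qed.

Let continuous_exp_neg : continuous (fun t => expR (- t)).
Proof.
move=> t; apply: continuous_comp; first exact: opp_continuous.
exact: continuous_expR.
Qed.

Lemma gamma_integrand_cvg0 s : 0 < s -> G s t @[t --> 0^'+] --> 0.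
Proof.
move=> s0; rewrite -[X in _ --> X](mul0r (expR (- 0))); apply: cvgM.
  exact: powR_cvg0.
by apply: cvg_at_right_filter; exact: continuous_exp_neg.
Qed.

Let is_derive_exp_neg t : is_derive t 1 (fun t => expR (- t)) (- expR (- t)).
Proof.
have := @is_derive1_comp R expR -%R t _ _ (is_derive_expR _)
  (is_deriveNid t 1).
by rewrite mulrN1.
Qed.

Lemma is_derive_gamma_integrand s t : 0 < t ->
  is_derive t 1 (G (s + 1)) ((s + 1) * G s t - G (s + 1) t).
Proof.
move=> t0.
have H1 := is_derive1_powR (s + 1) t0.
apply: (is_derive_eq (is_deriveM H1 (is_derive_exp_neg t))).
rewrite addrK /G /GRing.scale /=; ring.
Qed.

Lemma integrable_exp_neg :
  mu.-integrable `[0, +oo[ (EFin \o (fun t => expR (- t))).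
Proof.
have := integrable_gamma_integrand (lexx 0); congr (mu.-integrable _ _).
by apply/funext => t /=; rewrite /G powRr0 mul1r.
Qed.

Lemma Rintegral_exp_neg :
  \int[mu]_(t in `[0, +oo[) expR (- t) = 1.
Proof.
rewrite (@Rintegral_ge0_continuous_FTC2y _ _ (fun t => - expR (- t)) 0 0).
- by rewrite oppr0 expR0 sub0r opprK.
- by move=> t _; exact: expR_ge0.
- exact: continuous_subspaceT.
- rewrite -oppr0; apply: cvgN; exact: cvgr_expR.
- by move=> t _; apply: derivableN; have [] := is_derive_exp_neg t.
- by apply: cvgN; apply: cvg_at_right_filter; exact: continuous_exp_neg.
- move=> t _; rewrite derive1E.
  have := is_deriveN (is_derive_exp_neg t); rewrite opprK => H.
  exact: (@derive_val _ _ _ _ _ _ _ H).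
Qed.

Lemma continuous_gamma_integrand s t : 0 < t -> {for t, continuous (G s)}.
Proof.
move=> t0; have := is_derive_gamma_integrand (s - 1) t0; rewrite subrK => -[].
by move=> /derivable1_diffP/differentiable_continuous.
Qed.

Lemma gamma_integrand0 s : s != 0 -> G s 0 = 0.
Proof. by move=> s0; rewrite /G powR0 // mul0r. Qed.

(** Integration by parts.  The fundamental theorem on a half-line asks for an
    integrand of constant sign, which
      [(t^(s+1) - (s+1) t^s) e^-t = (- t^(s+1) e^-t)']
    has not; adding [K e^-t], whose integral is [K], makes it nonnegative. *)
Lemma Rintegral_gamma_integrandS s : 0 < s ->
  \int[mu]_(t in `[0, +oo[) G (s + 1) t =
  (s + 1) * \int[mu]_(t in `[0, +oo[) G s t.
Proof.
move=> s0.
have s1 : 0 < s + 1 by rewrite addr_gt0.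
have IG0 := integrable_gamma_integrand (ltW s0).
have IG1 := integrable_gamma_integrand (ltW s1).
(* [(s+1) t^s] is at most [t^(s+1)] if [t >= s+1], and at most [K] otherwise. *)
pose K := (s + 1) `^ (s + 1).
pose f t := G (s + 1) t - (s + 1) * G s t + K * expR (- t).
pose F t := - G (s + 1) t - K * expR (- t).
have If : \int[mu]_(t in `[0, +oo[) f t =
    \int[mu]_(t in `[0, +oo[) G (s + 1) t -
    (s + 1) * \int[mu]_(t in `[0, +oo[) G s t + K.
  rewrite /f RintegralD //; last 2 first.
  - rewrite (_ : _ \o _ =
      (fun t => (EFin \o G (s + 1)) t - (s + 1)%:E * (EFin \o G s) t)%E) //.
    by apply: integrableB => //; exact: integrableZl.
  - rewrite (_ : _ \o _ =
      (fun t => K%:E * (EFin \o (fun t => expR (- t))) t)%E) //.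
    by apply: integrableZl => //; exact: integrable_exp_neg.
  rewrite RintegralB //; last first.
    rewrite (_ : _ \o _ = (fun t => (s + 1)%:E * (EFin \o G s) t)%E) //.
    exact: integrableZl.
  rewrite !RintegralZl //; last exact: integrable_exp_neg.
  by rewrite Rintegral_exp_neg mulr1.
suff : \int[mu]_(t in `[0, +oo[) f t = K.
  by rewrite If => /eqP; rewrite -subr_eq0 addrK subr_eq0 => /eqP.
rewrite (@Rintegral_ge0_continuous_FTC2y _ f F 0 0).
- rewrite /F gamma_integrand0 ?gt_eqF // oppr0 expR0 mulr1.
  by rewrite !sub0r opprK.
- move=> t t0; rewrite /f /G.
  rewrite mulrA -mulrBl -mulrDl mulr_ge0 ?expR_ge0 //.
  rewrite addrAC subr_ge0.
  have pS x : 0 <= x -> x `^ (s + 1) = x * x `^ s.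
    by move=> x0; rewrite -(mulr_powRB1 x0 s1) addrK.
  rewrite /K !pS //; last exact: ltW.
  have [ts|ts] := leP (s + 1) t.
    by rewrite ler_wpDr ?ler_wpM2r ?powR_ge0 // mulr_ge0 ?powR_ge0 // ltW.
  rewrite ler_wpDl ?mulr_ge0 ?powR_ge0 // ler_wpM2l ?(ltW s1) //.
  by rewrite ge0_ler_powR ?nnegrE // ltW.
- apply/continuous_within_itvcyP; split => [t|].
    rewrite in_itv /= andbT => t0; apply: cvgD.
      apply: cvgB; first exact: continuous_gamma_integrand.
      by apply: cvgM; [exact: cvg_cst|exact: continuous_gamma_integrand].
    by apply: cvgM; [exact: cvg_cst|exact: continuous_exp_neg].
  apply: cvgD.
    apply: cvgB.
      by rewrite gamma_integrand0 ?gt_eqF //; exact: gamma_integrand_cvg0.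
    apply: cvgM; first exact: cvg_cst.
    by rewrite gamma_integrand0 ?gt_eqF //; exact: gamma_integrand_cvg0.
  apply: cvgM; first exact: cvg_cst.
  by apply: cvg_at_right_filter; exact: continuous_exp_neg.
- rewrite -[X in _ --> X](subrr 0) -{1}oppr0 -[X in _ - X](mulr0 K); apply: cvgB.
    by apply: cvgN; exact: gamma_integrand_cvgy (ltW s1).
  by apply: cvgM; [exact: cvg_cst|exact: cvgr_expR].
- move=> t t0; have [d1 _] := is_derive_gamma_integrand s t0.
  have [d2 _] := is_derive_exp_neg t.
  by apply: derivableB; [exact: derivableN|exact: derivableM].
- apply: cvgB.
    apply: cvgN; rewrite gamma_integrand0 ?gt_eqF //.
    exact: gamma_integrand_cvg0.
  apply: cvgM; first exact: cvg_cst.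
  by apply: cvg_at_right_filter; exact: continuous_exp_neg.
- move=> t; rewrite in_itv /= andbT => t0; rewrite derive1E.
  have H1 := is_deriveN (is_derive_gamma_integrand s t0).
  have H2 := is_deriveZ K (is_derive_exp_neg t).
  have H := is_deriveB H1 H2.
  rewrite (@derive_val _ _ _ _ _ _ _ H) /f /GRing.scale /=; ring.
Qed.

(** Closing the domain at [0] gives the form that the fundamental theorem on a
    half-line asks for. *)
Lemma GammaE (x : R) : 1 <= x ->
  Gamma x = \int[mu]_(t in `[0, +oo[) G (x - 1) t.
Proof.
move=> x1; have IG : mu.-integrable `[0, +oo[ (EFin \o G (x - 1)).
  by apply: integrable_gamma_integrand; rewrite subr_ge0.
apply: (@Rintegral_itv_obnd_cbnd _ _ _ (G (x - 1))).
apply: integrableS IG => //.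
by apply: subset_itvr; rewrite bnd_simp.
Qed.

Lemma GammaS (x : R) : 1 < x -> Gamma (x + 1) = x * Gamma x.
Proof.
move=> x1; rewrite !GammaE ?(ltW x1) //; last first.
  by rewrite ler_wpDl ?(le_trans ler01 (ltW x1)).
have := @Rintegral_gamma_integrandS (x - 1); rewrite subr_gt0 subrK addrK.
exact.
Qed.

(** On [[1, 2]] the integrand is at least [e^-2]. *)
Lemma Gamma_gt0 (x : R) : 1 <= x -> 0 < Gamma x.
Proof.
move=> x1; rewrite GammaE //.
have x0 : 0 <= x - 1 by rewrite subr_ge0.
have IG := integrable_gamma_integrand x0.
have sub : `[1, 2] `<=` (`[0, +oo[ : set R).
  by move=> t /=; rewrite !in_itv /= andbT => /andP[t1 _]; exact: le_trans t1.
apply: (@lt_le_trans _ _ (\int[mu]_(t in `[1, 2]) expR (- 2))).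
  have m12 : lebesgue_measure (`[1, 2] : set R) = 1%E.
    rewrite lebesgue_measure_itv /= lte_fin ltr1n -EFinD.
    by congr EFin; rewrite -[2]natr1 addrK.
  by rewrite Rintegral_cst // [X in fine X]m12 mulr1 expR_gt0.
apply: (@le_trans _ _ (\int[mu]_(t in `[1, 2]) G (x - 1) t)).
  apply: le_Rintegral => //.
  - apply: continuous_compact_integrable; first exact: segment_compact.
    by apply: continuous_subspaceT; exact: cst_continuous.
  - exact: integrableS IG.
  - move=> t /=; rewrite in_itv /= => /andP[t1 t2].
    rewrite -[leLHS]mul1r ler_pM ?expR_ge0 // ?ler_expR ?lerN2 //.
    by rewrite -[leLHS](powRr0 t) ler_powR.
rewrite fine_le ?integrable_fin_num //.
- exact: integrableS IG.
apply: ge0_subset_integral => //.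
- by apply/measurable_EFinP; exact: measurable_gamma_integrand.
- by move=> t _; rewrite lee_fin mulr_ge0 ?powR_ge0 ?expR_ge0.
Qed.

End Gamma.

(** Adding [1] to [x >= 0] does not change whether [x] is a natural number, so
    both sides are on the same branch of the definition. *)
Lemma rfactS (R : realType) (x : R) :
  0 <= x -> rfact (x + 1) = (x + 1) * rfact x.
Proof.
move=> x0; rewrite /rfact.
have -> : (x + 1 \is a Num.nat) = (x \is a Num.nat).
  apply/idP/idP => [|xn]; last by rewrite rpredD ?rpred1.
  move=> /natrP[[|n]]; first by move=> /eqP; rewrite gt_eqF // ltr_wpDl.
  by rewrite -natr1 => /addIr ->; rewrite natr_nat.
case: ifPn => [/natrP[n ->]|xn].
  by rewrite natr1 !natrK factS natrM.
rewrite GammaS // ltrDr lt_neqAle x0 andbT eq_sym.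
by apply: contraNneq xn => ->; rewrite rpred0.
Qed.

Lemma rfact_neq0 (R : realType) (x : R) : 0 <= x -> rfact x != 0.
Proof.
move=> x0; rewrite /rfact; case: ifP => _.
  by rewrite pnatr_eq0 -lt0n fact_gt0.
by rewrite gt_eqF // Gamma_gt0 // lerDr.
Qed.

Local Close Scope classical_set_scope.

(** * The theorem *)

Theorem theorem11 (R : realType) (a m : nat) :
  \det (\matrix_(i < a, j < a) (- (i == j)%:R + 'C(m + i + j, j)%:R) : 'M[R]_a) =
  if odd a then 0
  else (-1) ^+ a./2 *
    \prod_(0 <= i < a./2)
      ((i`!%:R ^+ 2 * rfact (m%:R / 2 + i%:R) ^+ 2 *
        rfact (m%:R / 2 + (3 * i + 1)%:R) ^+ 2 * (m + 3 * i + 1)`!%:R ^+ 2) /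
       ((2 * i)`!%:R * (2 * i + 1)`!%:R * rfact (m%:R / 2 + (2 * i)%:R) ^+ 2 *
        rfact (m%:R / 2 + (2 * i + 1)%:R) ^+ 2 * (m + 2 * i)`!%:R *
        (m + 2 * i + 1)`!%:R)) :> R.
Proof.
rewrite -/(cspp_mx R m a).
have Ea : a = (odd a + 2 * a./2)%N by rewrite mul2n odd_double_half.
case: ifP Ea => _; move: (a./2) => n ->.
  exact: det_cspp_odd.
rewrite add0n; apply: (@det_cspp_even R m n (@rfact R)).
  exact: rfact_neq0.
by move=> k; rewrite -[k.+1%:R]natr1 addrA rfactS // addr_ge0 // divr_ge0.
Qed.
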